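(* Let $R=\mathsf{k}\{x,y\}$, $\mathfrak{D}=\mathsf{k}_{DP}[X,Y]$, $S=\mathsf{k}\{x,y,z,w\}$, $\mathfrak{E}=\mathsf{k}_{DP}[X,Y,Z,W]$. Let $G=g+g_{13}$ with $g\in\mathfrak{D}_{14}$ homogeneous of degree $14$ and $g_{13}\in\mathfrak{E}$ homogeneous of degree $13$, let $B=S/\operatorname{Ann}_S G$, and assume $$H_B(0)=(1,2,3,4,5,6,7,8,7,6,5,4,3,2,1),\qquad H_B(1)=(0,2,4,6,4,2,0,0,2,4,6,4,2,0).$$ Then $H_B(2)_6\ge 4$.
   Context: $\mathsf{k}$ is a field; $S$ acts on $\mathfrak{E}$ by contraction ($x^{\alpha}\circ X^{[\beta]}=X^{[\beta-\alpha]}$ if $\beta\ge\alpha$ componentwise, $0$ otherwise). For $G$ of degree $j$, $B=S/\operatorname{Ann}_S G$ is Artinian Gorenstein of socle degree $j$ with maximal ideal $\mathfrak{m}_B$; $C_B(u)$ is the ideal of $B^*=\bigoplus_i\mathfrak{m}_B^i/\mathfrak{m}_B^{i+1}$ whose degree-$i$ part is the image of $\mathfrak{m}_B^i\cap(0:\mathfrak{m}_B^{\,j+1-u-i})$, and $H_B(u)_i=\dim_{\mathsf{k}}\big(C_B(u)/C_B(u+1)\big)_i$. *)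

(* Defs.v *)
From HB Require Import structures.
From mathcomp Require Import all_boot all_order all_algebra.
From mathcomp Require Import mpoly.
From Stdlib Require Import ClassicalEpsilon.

Set Implicit Arguments.
Unset Strict Implicit.
Unset Printing Implicit Defensive.

Import Order.TTheory GRing.Theory.
Local Open Scope ring_scope.

(* Variables are indexed 0 = x/X, 1 = y/Y, 2 = z/Z, 3 = w/W.
   S = k[x,y,z,w] : polynomials in 4 variables (acting ring).
   E = k_DP[X,Y,Z,W] : the divided power module; as a k-vector space it is
   represented by {mpoly k[4]}, where the basis element 'X_[b] stands for the
   divided power monomial X^[b].  Only the k-module structure of E and the
   contraction action are used. *)
Section Defs.
Variable k : fieldType.
Local Notation S := {mpoly k[4]}.
Local Notation E := {mpoly k[4]}.

Definition contract (f : S) (F : E) : E :=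
  \sum_(a <- msupp f) \sum_(b <- msupp F)
     (if (a <= b)%MM then (f@_a * F@_b) *: 'X_[(b - a)%MM] else 0).

Definition degDP (G : E) : nat := (msize G).-1.

Definition Ann (G : E) (f : S) : Prop := contract f G = 0.

(* the i-th power of the maximal ideal m = (x,y,z,w) of S:
   polynomials all of whose monomials have degree >= i *)
Definition mpow (i : nat) (f : S) : Prop :=
  forall a, a \in msupp f -> (i <= mdeg a)%N.

(* f + Ann G lies in m_B^i, where B = S / Ann_S G *)
Definition inmB (G : E) (i : nat) (f : S) : Prop :=
  exists h, mpow i h /\ Ann G (f - h).

(* f + Ann G lies in (0 : m_B^e) *)
Definition incolon (G : E) (e : nat) (f : S) : Prop :=
  forall h, mpow e h -> Ann G (f * h).

(* preimage in S of C_B(u)_i  (a subspace of m_B^i/m_B^{i+1}):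
   f is congruent mod m_B^{i+1} to an element of m_B^i cap (0 : m_B^{j+1-u-i}).
   (Exponents are truncated at 0; (0 : m_B^0) = (0 : B) = 0, matching the
   convention m_B^e = B for e <= 0.) *)
Definition Cpre (G : E) (u i : nat) (f : S) : Prop :=
  exists g, [/\ inmB G i g, incolon G (degDP G + 1 - u - i)%N g
              & inmB G i.+1 (f - g)].

Definition has_qdim (V U : S -> Prop) (n : nat) : Prop :=
  exists vs : n.-tuple S,
    [/\ forall i, V (tnth vs i),
        forall c : 'I_n -> k, U (\sum_i c i *: tnth vs i) -> forall i, c i = 0
      & forall v, V v -> exists c : 'I_n -> k, U (v - \sum_i c i *: tnth vs i)].

Definition qdim (V U : S -> Prop) : nat :=
  epsilon (inhabits 0%N) (has_qdim V U).

Definition HB (G : E) (u i : nat) : nat := qdim (Cpre G u i) (Cpre G u.+1 i).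

Definition inD (d : nat) (g : E) : Prop :=
  g \is d.-homog /\ forall a, a \in msupp g -> a (2 : 'I_4) = 0%N /\ a (3 : 'I_4) = 0%N.

End Defs.

(* Main.v *)
Require Import Defs.
From HB Require Import structures.
From mathcomp Require Import all_boot all_order all_algebra.
From mathcomp Require Import mpoly.
From mathcomp Require Import zify.
From Stdlib Require Import Classical ClassicalEpsilon.

Set Implicit Arguments.
Unset Strict Implicit.
Unset Printing Implicit Defensive.

Import Order.TTheory GRing.Theory.
Local Open Scope ring_scope.

(** Write [G = g + g13] and [R = k[x,y]].  Since [H_B(0)_7 = 8], contraction
    against [g] is an isomorphism from [R_7] to [D_7], so [D_7] carries the
    nondegenerate symmetric form [<r o g, r' o g> = (r r') o g].  Since
    [H_B(1)_6 = 0], [g13 = c + Z P + W Q] with [c], [P], [Q] in [D], and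
    [H_B(2)_6] is at least the rank of the form restricted to the space
    [R_5 o P + R_5 o Q], hence at least twice its dimension minus 8.
    Since [H_B(1)_3 = 6], the space [R_2 o P + R_2 o Q] has dimension at least 6.
    The Hilbert function of a quotient of [R] does not increase once it is
    smaller than that of [R], so [R_5 o P + R_5 o Q] also has dimension at
    least 6, and [6 + 6 - 8 = 4]. *)

(** * Rank bounds *)

Section Rank.
Variable k : fieldType.

Lemma row_free_of_ker m n (A : 'M[k]_(m, n)) :
  (forall u : 'rV_m, u *m A = 0 -> u = 0) -> row_free A.
Proof.
move=> injA; rewrite -kermx_eq0; apply/eqP/row_matrixP => i.
by rewrite row0; apply: injA; rewrite -row_mul mulmx_ker row0.
Qed.

Lemma mxrank_le_of_ker m n p (A : 'M[k]_(m, n)) (B : 'M[k]_(m, p)) :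
  (forall u : 'rV_m, u *m B = 0 -> u *m A = 0) -> (\rank A <= \rank B)%N.
Proof.
move=> kerBA.
have /mxrankS : (kermx B <= kermx A)%MS.
  apply/row_subP => i; apply/sub_kermxP/kerBA.
  by rewrite -row_mul mulmx_ker row0.
rewrite !mxrank_ker; have := rank_leq_row A; have := rank_leq_row B; lia.
Qed.

Definition pad0 m n (K : 'M[k]_(m, n)) : 'M[k]_(m, n.+1) :=
  \matrix_(i, j) (if unlift ord_max j is Some j' then K i j' else 0).
Definition shift0 m n (K : 'M[k]_(m, n)) : 'M[k]_(m, n.+1) :=
  \matrix_(i, j) (if unlift ord0 j is Some j' then K i j' else 0).

Lemma pad0_lift m n (K : 'M[k]_(m, n)) i j : pad0 K i (lift ord_max j) = K i j.
Proof. by rewrite mxE liftK. Qed.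

Lemma shift0_lift m n (K : 'M[k]_(m, n)) i j : shift0 K i (lift ord0 j) = K i j.
Proof. by rewrite mxE liftK. Qed.

Lemma mul_shift0 l m n (u : 'M_(l, m)) (K : 'M[k]_(m, n)) :
  u *m shift0 K = shift0 (u *m K).
Proof.
apply/matrixP => i j; rewrite !mxE; case: unliftP => [j' ->|->].
  by rewrite mxE; apply: eq_bigr => s _; rewrite shift0_lift.
by rewrite big1 // => s _; rewrite mxE unlift_none mulr0.
Qed.

Lemma mxrank_shift0 m n (K : 'M[k]_(m, n)) : \rank (shift0 K) = \rank K.
Proof.
apply/eqP; rewrite eqn_leq; apply/andP; split; apply: mxrank_le_of_ker => u.
  move=> uK0; apply/matrixP => i j; rewrite mul_shift0 uK0 !mxE.
  by case: unlift => // j'; rewrite mxE.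
rewrite mul_shift0 => uK0; apply/matrixP => i j.
by rewrite -shift0_lift uK0 !mxE.
Qed.

(* Rows are binary forms of degree [n - 1] and [pad0], [shift0] multiply by the
   two variables: equality of ranks would make every form in the span divisible
   by arbitrarily high powers of one variable. *)
Lemma mxrank_pad0_shift0 m n (K : 'M[k]_(m, n)) :
  K != 0 -> (\rank K < \rank (pad0 K + shift0 K)%MS)%N.
Proof.
apply: contraNltn; rewrite -[\rank K]mxrank_shift0 => le_rank.
have : (pad0 K <= shift0 K)%MS.
  rewrite (submx_trans (addsmxSl _ (shift0 K))) //.
  have [_ <-] := mxrank_leqif_sup (addsmxSr (pad0 K) (shift0 K)).
  by rewrite eqn_leq le_rank mxrankS // addsmxSr.
case/submxP => C eqC.
suff K0 b (ltbn : (b < n)%N) i : K i (Ordinal ltbn) = 0.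
  by apply/eqP/matrixP => i [b ltbn]; rewrite K0 mxE.
elim: b ltbn i => [|b IHb] ltbn i.
  rewrite -pad0_lift eqC mul_shift0 mxE; case: unliftP => // j /(congr1 val) /=.
  by rewrite /bump /=; lia.
rewrite -pad0_lift eqC mul_shift0 mxE; case: unliftP => // j /(congr1 val) /=.
rewrite /bump /= leqNgt ltbn /= add0n add1n => -[eqj].
rewrite mxE big1 // => s _; have ltb : (b < n)%N by lia.
have -> : j = Ordinal ltb by apply: val_inj; rewrite /= -eqj.
by rewrite IHb mulr0.
Qed.

(** The catalecticant of a binary divided power form with coefficients [p]: row [i] lists the
    coefficients of its contraction by [x^i y^(m-1-i)]. *)
Definition hankel m n (p : nat -> k) : 'M[k]_(m, n) := \matrix_(i, j) p (i + j)%N.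

Lemma trmx_hankel m n p : (hankel m n p)^T = hankel n m p.
Proof. by apply/matrixP => i j; rewrite !mxE addnC. Qed.

(** Annihilators are ideals: a form annihilating the one with coefficients [p] still does so after
    multiplication by [y] ([pad0]) or by [x] ([shift0]). *)
Lemma pad0_hankel l m n (u : 'M[k]_(l, n)) (p : nat -> k) :
  u *m hankel n m.+1 p = 0 -> pad0 u *m hankel n.+1 m p = 0.
Proof.
move=> u0; apply/matrixP => i j; rewrite !mxE big_ord_recr /= mxE.
rewrite [X in X * _](_ : _ = 0) ?mul0r ?addr0; last first.
  by case: unliftP => // j' /(congr1 val) /=; rewrite /bump; have := ltn_ord j'; lia.
have := congr1 (fun M : 'M_(_, _) => M i (widen_ord (leqnSn m) j)) u0.
rewrite !mxE => e0; rewrite -[RHS]e0; apply: eq_bigr => s _.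
rewrite !mxE /=; congr (_ * _).
have -> : widen_ord (leqnSn n) s = lift ord_max s.
  by apply: val_inj; rewrite /= /bump; have := ltn_ord s; lia.
by rewrite liftK.
Qed.

Lemma shift0_hankel l m n (u : 'M[k]_(l, n)) (p : nat -> k) :
  u *m hankel n m.+1 p = 0 -> shift0 u *m hankel n.+1 m p = 0.
Proof.
move=> u0; apply/matrixP => i j; rewrite !mxE big_ord_recl /= mxE unlift_none.
rewrite mul0r add0r.
have := congr1 (fun M : 'M_(_, _) => M i (lift ord0 j)) u0.
rewrite !mxE => e0; rewrite -[RHS]e0; apply: eq_bigr => s _.
rewrite !mxE liftK; congr (_ * p _).
by rewrite /= /bump /=; lia.
Qed.

(** Rows are forms of degree [n - 1] acting on a pair [(P, Q)], so the left kernel is a graded piece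
    of [Ann(P, Q)]; the columns span [R_(m-1) o P + R_(m-1) o Q]. *)
Definition hankel2 m n (p q : nat -> k) : 'M[k]_(n, m + m) :=
  row_mx (hankel n m p) (hankel n m q).

(* The Hilbert function of [k[x,y]/Ann(P,Q)] does not increase once it is
   smaller than that of [k[x,y]]. *)
Lemma mxrank_hankel2 m n p q : (\rank (hankel2 m.+1 n p q) < n)%N ->
  (\rank (hankel2 m n.+1 p q) <= \rank (hankel2 m.+1 n p q))%N.
Proof.
move=> ltn; set A := hankel2 m.+1 n p q; set B := hankel2 m n.+1 p q.
have kerA : kermx A *m A = 0 by apply: mulmx_ker.
have [kp kq] : kermx A *m hankel n m.+1 p = 0 /\ kermx A *m hankel n m.+1 q = 0.
  by apply/eq_row_mx; rewrite -mul_mx_row kerA row_mx0.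
have sub : (pad0 (kermx A) + shift0 (kermx A) <= kermx B)%MS.
  rewrite addsmx_sub; apply/andP; split; apply/sub_kermxP; rewrite mul_mx_row.
    by rewrite !pad0_hankel // row_mx0.
  by rewrite !shift0_hankel // row_mx0.
(* This nonzero piece of the annihilator gains at least one dimension under multiplication by [x]
   and [y], while the space of forms gains exactly one. *)
have nz : kermx A != 0 by rewrite -mxrank_eq0 mxrank_ker -lt0n subn_gt0.
have := leq_trans (mxrank_pad0_shift0 nz) (mxrankS sub).
rewrite !mxrank_ker; have := rank_leq_row B; rewrite -/A in ltn *; lia.
Qed.

(** Sylvester's rank inequality: on an [r]-dimensional subspace, the radical of a nondegenerate form
    lies in an orthogonal complement of dimension [n - r]. *)
Lemma mxrank_congr_ge n m (A : 'M[k]_(m, n)) (T : 'M[k]_n) :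
  T \in unitmx -> (\rank A + \rank A - n <= \rank (A *m T *m A^T))%N.
Proof.
move=> unitT; have := mxrank_mul_min (A *m T) A^T.
by rewrite mxrank_tr mxrankMfree // row_free_unit.
Qed.

End Rank.

(** * Contraction in coordinates *)

Section Contraction.
Variable k : fieldType.
Local Notation S := {mpoly k[4]}.
Implicit Types (f h F G : S) (a b c : 'X_{1..4}).

(** The coefficient of [c] in [contract f F], packaged as a linear functional of [f]; conditions
    modulo [Ann G] are tested on these functionals. *)
Definition pairing F c f : k := \sum_(a <- msupp f) f@_a * F@_(a + c).

Lemma pairing_seq F c f (s : seq 'X_{1..4}) : uniq s ->
  (forall a, f@_a != 0 -> F@_(a + c) != 0 -> a \in s) ->
  pairing F c f = \sum_(a <- s) f@_a * F@_(a + c).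
Proof.
move=> uniq_s sub_s; rewrite /pairing.
rewrite [LHS](bigID (mem s)) /= [X in _ + X]big1_seq ?addr0; last first.
  move=> a /andP[a_s]; rewrite mcoeff_msupp => fa.
  by apply/eqP; rewrite mulf_eq0 (negPf fa) /=; apply: contraNT a_s; apply: sub_s.
rewrite [RHS](bigID (mem (msupp f))) /= [X in _ + X]big1_seq ?addr0; last first.
  by move=> a /andP[/memN_msupp_eq0 -> _]; rewrite mul0r.
rewrite -big_filter -[RHS]big_filter; apply: perm_big; apply: uniq_perm.
- exact/filter_uniq/msupp_uniq.
- exact: filter_uniq.
by move=> a; rewrite !mem_filter andbC.
Qed.

Lemma mcoeff_contract f F c : (contract f F)@_c = pairing F c f.
Proof.
rewrite /contract raddf_sum /=; apply: eq_bigr => a _; rewrite raddf_sum /=.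
rewrite (eq_bigr (fun b => if b == (a + c)%MM then f@_a * F@_(a + c) else 0)).
  rewrite -big_mkcond big_const_seq iter_addr_0.
  rewrite (eq_count (a2 := pred1 (a + c)%MM)) ?count_uniq_mem ?msupp_uniq //.
  by rewrite mcoeff_msupp; case: eqP => [->|]; rewrite ?mulr1n ?mulr0.
move=> b _; have [->|neq_b] := eqVneq b (a + c)%MM.
  have -> : (a <= a + c)%MM by apply/mnm_lepP => i; rewrite mnmDE leq_addr.
  by rewrite mcoeffZ mcoeffX [(a + c)%MM]addmC addmK eqxx mulr1.
case: ifP => [le_ab|]; last by rewrite mcoeff0.
rewrite mcoeffZ mcoeffX; case: eqP => [e|]; last by rewrite mulr0.
by rewrite -e addmC submK ?eqxx in neq_b.
Qed.

Lemma pairing_is_linear F c : linear_for *%R (pairing F c).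
Proof.
move=> u f h; pose s := undup (msupp f ++ msupp h).
have in_s h' : (forall a, h'@_a != 0 -> (f@_a != 0) || (h@_a != 0)) ->
    pairing F c h' = \sum_(a <- s) h'@_a * F@_(a + c).
  move=> sub; apply: pairing_seq; first exact: undup_uniq.
  by move=> a /sub; rewrite mem_undup mem_cat !mcoeff_msupp.
rewrite (in_s f); last by move=> a ->.
rewrite (in_s h); last by move=> a ->; rewrite orbT.
rewrite in_s; last first.
  move=> a; rewrite mcoeffD mcoeffZ; apply: contraNT; rewrite negb_or !negbK.
  by case/andP => /eqP-> /eqP->; rewrite mulr0 addr0.
rewrite mulr_sumr -big_split; apply: eq_bigr => a _ /=.
by rewrite mcoeffD mcoeffZ mulrDl mulrA.
Qed.

HB.instance Definition _ F c :=
  GRing.isLinear.Build k S k *%R (pairing F c) (pairing_is_linear F c).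

Lemma pairingX F c a : pairing F c 'X_[a] = F@_(a + c).
Proof. by rewrite /pairing msuppX big_seq1 mcoeffX eqxx mul1r. Qed.

Lemma pairing_mulX F c f b : pairing F c (f * 'X_[b]) = pairing F (b + c) f.
Proof.
rewrite [f]mpolyE mulr_suml !linear_sum; apply: eq_bigr => a _ /=.
by rewrite -scalerAl -mpolyXD !linearZ /= !pairingX addmA.
Qed.

(** * Ideals of [B] as conditions on coefficients *)

Lemma Ann_pairing G f : Ann G f <-> forall c, pairing G c f = 0.
Proof.
split=> [fG c|fG]; first by rewrite -mcoeff_contract fG mcoeff0.
by apply/mpolyP => c; rewrite mcoeff_contract fG mcoeff0.
Qed.

Lemma mpowP i f : mpow i f <-> forall a, (mdeg a < i)%N -> f@_a = 0.
Proof.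
split=> [fi a lt_ai|fi a].
  by apply: memN_msupp_eq0; apply/negP => /fi; rewrite leqNgt lt_ai.
by rewrite mcoeff_msupp leqNgt; apply: contraNN => /fi ->.
Qed.

Lemma mpowX i a : (i <= mdeg a)%N -> mpow i ('X_[a] : S).
Proof. by move=> le_ia b; rewrite msuppX inE => /eqP->. Qed.

Lemma mpowS i f : mpow i.+1 f -> mpow i f.
Proof. by move=> fi a /fi /ltnW. Qed.

Lemma mpow_homog i f : f \is i.-homog -> mpow i f.
Proof. by move=> /dhomogP fi a /fi ->. Qed.

Lemma mpow0 i : mpow i (0 : S).
Proof. by apply/mpowP => a _; rewrite mcoeff0. Qed.

Lemma mpow_lin i u f h : mpow i f -> mpow i h -> mpow i (u *: f + h).
Proof.
move=> /mpowP fi /mpowP hi; apply/mpowP => a lt_ai.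
by rewrite mcoeffD mcoeffZ fi ?hi // mulr0 addr0.
Qed.

(** Multiplying [f] by a monomial shifts the coefficients of [f o G], so killing [m^e] amounts to a
    bound on the degree of [f o G]. *)
Lemma incolonP G e f :
  incolon G e f <-> forall c, (e <= mdeg c)%N -> pairing G c f = 0.
Proof.
split=> [fe c le_ec|fe h he].
  have /Ann_pairing/(_ 0%MM) := fe _ (mpowX le_ec).
  by rewrite pairing_mulX addm0.
apply/Ann_pairing => c; rewrite [h]mpolyE mulr_sumr linear_sum big1_seq //=.
move=> a /he le_ea; rewrite -scalerAr linearZ /= pairing_mulX fe ?mulr0 //.
by rewrite mdegD (leq_trans le_ea) ?leq_addr.
Qed.

Lemma inmBP G i f :
  inmB G i f <-> exists2 h, mpow i h & forall c, pairing G c f = pairing G c h.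
Proof.
split=> [[h [hi /Ann_pairing fh]]|[h hi fh]]; exists h.
- by [].
- by move=> c; have /eqP := fh c; rewrite linearB subr_eq0 => /eqP.
split=> //; apply/Ann_pairing => c; by rewrite linearB /= fh subrr.
Qed.

Lemma inmB_lin G i u f h : inmB G i f -> inmB G i h -> inmB G i (u *: f + h).
Proof.
move=> /inmBP[f' f'i ff'] /inmBP[h' h'i hh']; apply/inmBP.
exists (u *: f' + h'); first exact: mpow_lin.
by move=> c; rewrite !linearP /= ff' hh'.
Qed.

Lemma inmB_mpow G i f : mpow i f -> inmB G i f.
Proof. by move=> fi; apply/inmBP; exists f. Qed.

Lemma inmBS G i f : inmB G i.+1 f -> inmB G i f.
Proof. by move=> /inmBP[h hi fh]; apply/inmBP; exists h => //; apply: mpowS. Qed.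

Lemma inmBB G i f h : inmB G i f -> inmB G i h -> inmB G i (f - h).
Proof.
by move=> fi hi; rewrite -scaleN1r addrC; apply: inmB_lin.
Qed.

Lemma mcoeff_pihomog i f a :
  (pihomog mdeg i f)@_a = if mdeg a == i then f@_a else 0.
Proof.
rewrite pihomogE raddf_sum big_mkcond /= [in RHS](mpolyE f) raddf_sum /=.
case: eqP => [ai|ai]; last rewrite big1 //; first apply: eq_bigr;
  move=> b _; rewrite mcoeffZ mcoeffX; case: (b =P a) => [->|_].
- by rewrite ai eqxx.
- by rewrite mulr0 if_same.
- by move/eqP/negPf: ai => ->.
by rewrite mulr0 if_same.
Qed.

Lemma inmB_homog G i f : inmB G i f ->
  exists2 h, h \is i.-homog & inmB G i.+1 (f - h).
Proof.
move=> /inmBP[f' f'i ff']; exists (pihomog mdeg i f'); first exact: pihomogP.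
apply/inmBP; exists (f' - pihomog mdeg i f'); last first.
  by move=> c; rewrite !linearB /= ff'.
apply/mpowP => a; rewrite ltnS leq_eqVlt mcoeffB mcoeff_pihomog.
case: eqP => [_ _|_ /= lt_ai]; first by rewrite subrr.
by have /mpowP -> := f'i; rewrite ?subr0.
Qed.

(** The witness of [Cpre] is taken to be [f - h]: its colon condition then says that [f o G] and
    [h o G] have the same coefficients in high degrees. *)
Lemma Cpre_pairing G u i f : Cpre G u i f <->
  inmB G i f /\ exists2 h, mpow i.+1 h &
    forall c, (degDP G + 1 - u - i <= mdeg c)%N -> pairing G c f = pairing G c h.
Proof.
split=> [[g [gi /incolonP gc fg]]|[fi [h hi fh]]].
  split.
    have := inmB_lin 1 (inmBS fg) gi; by rewrite scale1r subrK.
  have /inmBP[h hi fgh] := fg; exists h => // c /gc gc0.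
  by rewrite -fgh linearB /= gc0 subr0.
exists (f - h); split.
- by apply: inmBB => //; apply/inmB_mpow/mpowS.
- by apply/incolonP => c /fh fhc; rewrite linearB /= fhc subrr.
by rewrite opprB addrC subrK; apply: inmB_mpow.
Qed.

Lemma Cpre_sub_inmB G u i f : Cpre G u i f -> inmB G i f.
Proof. by case/Cpre_pairing. Qed.

Lemma Cpre_lin G u i s f h :
  Cpre G u i f -> Cpre G u i h -> Cpre G u i (s *: f + h).
Proof.
move=> /Cpre_pairing[fi [f' f'i ff']] /Cpre_pairing[hi [h' h'i hh']].
apply/Cpre_pairing; split; first exact: inmB_lin.
exists (s *: f' + h'); first exact: mpow_lin.
by move=> c le_c; rewrite !linearP /= ff' ?hh'.
Qed.

Lemma Cpre_inmB G u i f : inmB G i.+1 f -> Cpre G u i f.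
Proof.
move=> fi; apply/Cpre_pairing; split; first exact: inmBS.
by have /inmBP[h hi fh] := fi; exists h.
Qed.

Lemma Cpre_eq G u i f h : inmB G i.+1 (f - h) -> Cpre G u i h -> Cpre G u i f.
Proof.
by move=> fh hi; rewrite -[f](subrK h) -[f - h]scale1r; apply/Cpre_lin/hi/Cpre_inmB.
Qed.

Lemma Cpre_sum G u i n (c : 'I_n -> k) (v : 'I_n -> S) :
  (forall j, Cpre G u i (v j)) -> Cpre G u i (\sum_j c j *: v j).
Proof.
move=> vC; elim/big_rec: _ => [|j f _ fC]; last exact: Cpre_lin.
exact/Cpre_inmB/inmB_mpow/mpow0.
Qed.

Lemma inmB_sum G i n (c : 'I_n -> k) (v : 'I_n -> S) :
  (forall j, inmB G i (v j)) -> inmB G i (\sum_j c j *: v j).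
Proof.
move=> vC; elim/big_rec: _ => [|j f _ fC]; last exact: inmB_lin.
exact/inmB_mpow/mpow0.
Qed.

(** * Existence of the dimensions [HB] and choice of bases *)

Lemma Ann_mpow G f : mpow (msize G) f -> Ann G f.
Proof.
move=> fG; apply/Ann_pairing => c; rewrite /pairing big1_seq // => a /andP[_ /fG le_a].
rewrite [X in _ * X]memN_msupp_eq0 ?mulr0 //; apply: msize_mdeg_ge.
by rewrite mdegD (leq_trans le_a) ?leq_addr.
Qed.

(** [qdim] is chosen by [epsilon], so its value is meaningful only once some dimension exists. As
    [U] contains [m^d], independent families have bounded size, and a maximal one spans. *)
Lemma has_qdim_exists (V U : S -> Prop) d :
  (forall s f h, U f -> U h -> U (s *: f + h)) ->
  (forall f, mpow d f -> U f) -> exists n, has_qdim V U n.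
Proof.
move=> Ulin Ud.
pose indep n := exists vs : n.-tuple S, (forall i, V (tnth vs i)) /\
  forall c : 'I_n -> k, U (\sum_i c i *: tnth vs i) -> forall i, c i = 0.
have bound n : indep n -> (n <= #|{: 'X_{1..4 < d}}|)%N.
  case=> vs [_ vsU].
  pose A : 'M[k]_(n, #|{: 'X_{1..4 < d}}|) :=
    \matrix_(i, j) (tnth vs i)@_(enum_val j : 'X_{1..4 < d}).
  suff /eqP <- : row_free A by apply: rank_leq_col.
  apply: row_free_of_ker => u uA0; apply/rowP => i; rewrite mxE.
  apply: (vsU (u 0)); apply/Ud/mpowP => a lt_ad; rewrite raddf_sum /=.
  have := congr1 (fun M : 'rV_ _ => M 0 (enum_rank (BMultinom lt_ad))) uA0.
  rewrite !mxE => e0; rewrite -[RHS]e0; apply: eq_bigr => j _.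
  by rewrite mcoeffZ mxE enum_rankK.
have [n [indep_n max_n]] : exists n, indep n /\ ~ indep n.+1.
  apply: NNPP => nomax.
  have all_indep n : indep n.
    elim: n => [|n IHn]; last by apply: NNPP => nindep; apply: nomax; exists n.
    by exists [tuple]; split=> [[]|c _ []].
  by have := bound _ (all_indep (#|{: 'X_{1..4 < d}}|).+1); rewrite ltnn.
exists n; case: indep_n => vs [vsV vsU]; exists vs; split=> // v Vv.
apply: NNPP => nspan; apply: max_n; exists [tuple of v :: vs]; split.
  by move=> i; case: (unliftP ord0 i) => [j ->|->]; rewrite ?tnthS ?tnth0.
move=> c; rewrite big_ord_recl tnth0 (eq_bigr (fun i => c (lift ord0 i) *: tnth vs i));
  last by move=> i _; rewrite tnthS.
have [c0|c0] := eqVneq (c ord0) 0; last first.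
  move=> Uc; case: nspan; exists (fun i => - (c ord0)^-1 * c (lift ord0 i)).
  have U0 : U 0 by apply: Ud; apply: mpow0.
  have := Ulin (c ord0)^-1 _ _ Uc U0.
  rewrite addr0 scalerDr scalerA mulVf // scale1r scaler_sumr; congr U.
  congr (_ + _); rewrite -sumrN; apply: eq_bigr => i _.
  by rewrite mulNr scaleNr opprK scalerA.
rewrite c0 scale0r add0r => /vsU c_lift i.
by case: (unliftP ord0 i) => [j ->|->].
Qed.

Lemma HB_has_qdim G u i : has_qdim (Cpre G u i) (Cpre G u.+1 i) (HB G u i).
Proof.
apply: epsilon_spec; apply: (@has_qdim_exists _ _ (maxn (msize G) i.+1)).
  exact: Cpre_lin.
by move=> f fd; apply/Cpre_inmB/inmB_mpow => a /fd; rewrite geq_max => /andP[].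
Qed.

(** A basis element may be replaced by the degree [i] part of a representative in [m^i], because
    [Cpre] contains [m_B^(i+1)]. *)
Lemma has_qdim_homog G u i n : has_qdim (Cpre G u i) (Cpre G u.+1 i) n ->
  exists v : 'I_n -> S, [/\ forall l, v l \is i.-homog,
    forall l, Cpre G u i (v l) &
    forall c : 'I_n -> k, Cpre G u.+1 i (\sum_l c l *: v l) -> forall l, c l = 0].
Proof.
case=> vs [vsV vsU _].
have /fin_all_exists2[v v_homog vsv] l := inmB_homog (Cpre_sub_inmB (vsV l)).
exists v; split=> // [l|c cU].
  apply: Cpre_eq (vsV l); have := inmB_lin (-1) (vsv l) (inmB_mpow G (@mpow0 i.+1)).
  by rewrite addr0 scaleN1r opprB.
apply: vsU; apply: Cpre_eq cU; rewrite -sumrB.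
by under eq_bigr do rewrite -scalerBr; apply: inmB_sum.
Qed.

End Contraction.

(** * Monomials in four variables *)

Definition mon4 (a b c d : nat) : 'X_{1..4} := Multinom [tuple a; b; c; d].

Variant mon4_spec : 'X_{1..4} -> Type :=
  Mon4Spec a b c d : mon4_spec (mon4 a b c d).

Lemma mon4P m : mon4_spec m.
Proof.
have -> : m = mon4 (m (inord 0)) (m (inord 1)) (m (inord 2)) (m (inord 3)).
  apply/mnmP => i; rewrite multinomE.
  case: i => [[|[|[|[|i]]]] lt_i4] //=; congr (m _); apply: val_inj;
    by rewrite /= inordK.
exact: Mon4Spec.
Qed.

Lemma mon4D a b c d a' b' c' d' :
  (mon4 a b c d + mon4 a' b' c' d')%MM = mon4 (a + a') (b + b') (c + c') (d + d').
Proof.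
by apply/mnmP => -[[|[|[|[|i]]]] lt_i4] //; rewrite mnmDE !multinomE.
Qed.

Lemma mdeg_mon4 a b c d : mdeg (mon4 a b c d) = (a + b + c + d)%N.
Proof. by rewrite mdegE !big_ord_recl big_ord0 !multinomE /= addn0 !addnA. Qed.

Lemma mon4_inj1 a b c d a' b' c' d' : mon4 a b c d = mon4 a' b' c' d' -> a = a'.
Proof. by case. Qed.

Lemma mon4_inj3 a b c d a' b' c' d' : mon4 a b c d = mon4 a' b' c' d' -> c = c'.
Proof. by case. Qed.

Lemma homog_mon4 (k : fieldType) n (f : {mpoly k[4]}) a b c d : f \is n.-homog ->
  f@_(mon4 a b c d) != 0 -> (a + b + c + d = n)%N.
Proof.
by move=> f_homog; rewrite -mcoeff_msupp -mdeg_mon4; apply: (dhomog_mf f_homog).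
Qed.

(** * The theorem in coordinates *)

Section Coordinates.
Variables (k : fieldType) (G : {mpoly k[4]}).
Implicit Types f h : {mpoly k[4]}.

Hypothesis degG : degDP G = 14.
Hypothesis suppG : forall a b c d, G@_(mon4 a b c d) != 0 ->
  (a + b + c + d = 13 \/ a + b = 14 /\ c + d = 0)%N.

(** The coefficients of [g], [P] and [Q], indexed by the exponent of [X]. *)
Let gam n := G@_(mon4 n (14 - n) 0 0).
Let pz n := G@_(mon4 n (12 - n) 1 0).
Let pw n := G@_(mon4 n (12 - n) 0 1).

Lemma G_eq0 a b c d :
  ~ ((a + b + c + d = 13 \/ a + b = 14 /\ c + d = 0)%N) ->
  G@_(mon4 a b c d) = 0.
Proof. by move=> nsupp; apply/eqP; apply/negPn/negP => /suppG. Qed.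

Lemma pairing_eq0 c f : (forall a, f@_a != 0 -> G@_(a + c) = 0) -> pairing G c f = 0.
Proof.
move=> fG; rewrite (@pairing_seq _ _ _ _ [::]) ?big_nil // => a /fG ->.
by rewrite eqxx.
Qed.

Lemma mpow_mon4 d f a b c e : mpow d f -> f@_(mon4 a b c e) != 0 ->
  (d <= a + b + c + e)%N.
Proof. by move=> fd; rewrite -mcoeff_msupp => /fd; rewrite mdeg_mon4. Qed.

(** The total degree is at least 14, where only [g] contributes, so only monomials of [f] in [x, y]
    of degree [d] survive. *)
Lemma pairing_gam d f b : (d <= 14)%N -> mpow d f -> (b <= 14 - d)%N ->
  pairing G (mon4 b (14 - d - b) 0 0) f =
    \sum_(i < d.+1) f@_(mon4 i (d - i) 0 0) * gam (i + b).
Proof.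
move=> le_d14 fd le_b.
rewrite (@pairing_seq _ _ _ _ [seq mon4 i (d - i) 0 0 | i : 'I_d.+1]).
- rewrite big_map big_enum; apply: eq_bigr => i _; congr (_ * _).
  by rewrite mon4D; congr (G@_(mon4 _ _ _ _)); have := ltn_ord i; lia.
- by rewrite map_inj_uniq ?enum_uniq // => i j /mon4_inj1/val_inj.
move=> a; case: (mon4P a) => a0 a1 a2 a3 /(mpow_mon4 fd) le_d; rewrite mon4D.
move=> /suppG Ga; have lt_a0 : (a0 < d.+1)%N by lia.
apply/mapP; exists (Ordinal lt_a0); rewrite ?mem_enum //=.
by congr mon4; lia.
Qed.

Lemma pairing_top d f c : mpow d f -> (14 - d <= mdeg c)%N ->
  (forall b, (b <= 14 - d)%N -> pairing G (mon4 b (14 - d - b) 0 0) f = 0) ->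
  pairing G c f = 0.
Proof.
move=> fd; case: (mon4P c) => c0 c1 c2 c3; rewrite mdeg_mon4 => le_c f0.
have [[c0_le [-> [-> ->]]]|nc] :
    (c0 <= 14 - d /\ c1 = 14 - d - c0 /\ c2 = 0 /\ c3 = 0 \/
    ~ (c0 <= 14 - d /\ c1 = 14 - d - c0 /\ c2 = 0 /\ c3 = 0))%N by lia.
  exact: f0.
apply: pairing_eq0 => a; case: (mon4P a) => a0 a1 a2 a3 /(mpow_mon4 fd) le_d.
by rewrite mon4D; apply: G_eq0; lia.
Qed.

Lemma Cpre_intro u i f : mpow i f ->
  (forall c, (15 - u - i <= mdeg c)%N -> pairing G c f = 0) -> Cpre G u i f.
Proof.
move=> fi f0; apply/Cpre_pairing; split; first exact: inmB_mpow.
by exists 0; [apply: mpow0 | move=> c; rewrite degG linear0; apply: f0].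
Qed.

(** * Consequences of [H_B(0)_7 = 8] and [H_B(1)_6 = 0] *)

Local Notation T := (hankel 8 8 gam).

(** Take eight forms of degree 7 independent modulo [C(1)]. If the [x, y] part of a combination [f]
    annihilates [g], then [f o G] has no coefficient in degree 7 or more, so [f] lies in [C(1)] and
    is trivial. *)
Lemma hankel_gam_unit : HB G 0 7 = 8 -> T \in unitmx.
Proof.
move=> HB07; have := HB_has_qdim G 0 7; rewrite HB07.
move=> /has_qdim_homog[v [v_homog _ vU]].
pose A : 'M[k]_8 := \matrix_(l, i) (v l)@_(mon4 i (7 - i) 0 0).
suff /eqP rankAT : row_free (A *m T).
  rewrite -row_free_unit /row_free eqn_leq rank_leq_row /=.
  by rewrite -[X in (X <= _)%N]rankAT mxrankM_maxr.
apply: row_free_of_ker => u uAT0; apply/rowP => l; rewrite mxE.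
apply: (vU (u 0)).
have f7 : mpow 7 (\sum_l u 0 l *: v l).
  elim/big_rec: _ => [|j f _ fi]; first exact: mpow0.
  exact/mpow_lin/fi/mpow_homog.
apply: Cpre_intro => // c le_c; apply: (pairing_top f7 le_c) => b le_b.
rewrite pairing_gam //.
have := congr1 (fun M : 'rV_ _ => M 0 (inord b)) uAT0.
rewrite mulmxA !mxE => e0; rewrite -[RHS]e0; apply: eq_bigr => i _.
rewrite !mxE inordK; last by lia.
congr (_ * _); rewrite raddf_sum /=; apply: eq_bigr => j _.
by rewrite mcoeffZ mxE.
Qed.

(** Such a monomial lies in [C(1)_6], because [G] has no monomial of degree 14 or more involving [Z]
    or [W]; the vanishing of [HB G 1 6] then puts it in [C(2)_6]. *)
Lemma Cpre_2_6 m : HB G 1 6 = 0%N -> mdeg m = 6 ->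
  (0 < m (inord 2) + m (inord 3))%N -> Cpre G 2 6 'X_[m].
Proof.
move=> HB16; have := HB_has_qdim G 1 6; rewrite HB16 => -[vs [_ _ span]].
case: (mon4P m) => a b c d; rewrite mdeg_mon4 !multinomE !(tnth_nth 0%N) /=.
rewrite !inordK //= => deg6 cd.
have [] := span 'X_[mon4 a b c d]; last by move=> s; rewrite big_ord0 subr0.
apply: Cpre_intro; first by apply: mpowX; rewrite mdeg_mon4 deg6.
move=> e; case: (mon4P e) => e0 e1 e2 e3; rewrite mdeg_mon4 => le_e.
by rewrite pairingX mon4D; apply: G_eq0; lia.
Qed.

Lemma split_zw a b c d : (a + b + c + d = 13)%N -> (1 < c + d)%N ->
  exists m0 m1 m2 m3 n0 n1 n2 n3, (a = m0 + n0 /\ b = m1 + n1 /\ c = m2 + n2 /\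
    d = m3 + n3 /\ m0 + m1 + m2 + m3 = 6 /\ 0 < m2 + m3 /\ 0 < n2 + n3)%N.
Proof.
move=> deg13 cd2.
(* [s] is the degree in [x, y] of the factor of degree 6: as large as possible, but at most 5 so
   that this factor keeps a [z] or [w]. *)
have [s [ms sab s5 s6]] : exists s, [/\ (s = a + b \/ s = 5)%N, (s <= a + b)%N,
    (s <= 5)%N & (6 - s < c + d)%N].
  have [le5|lt5] := leqP (a + b) 5; [exists (a + b)%N | exists 5]; split; lia.
have [m0 m0P] : exists m0, (m0 <= a /\ m0 <= s /\ s - m0 <= b)%N.
  by have [le|lt] := leqP a s; [exists a | exists s]; lia.
have [m2 m2P] : exists m2, (m2 <= c /\ m2 <= 6 - s /\ 6 - s - m2 <= d)%N.
  by have [le|lt] := leqP c (6 - s); [exists c | exists (6 - s)%N]; lia.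
exists m0, (s - m0)%N, m2, (6 - s - m2)%N.
exists (a - m0)%N, (b - (s - m0))%N, (c - m2)%N, (d - (6 - s - m2))%N; lia.
Qed.

(** An exponent of degree 13 with two factors among [Z, W] splits into parts of degrees 6 and 7,
    both involving them. The first gives an element of [C(2)], so the coefficient equals one of
    [h o G] with [h] in [m^7], which vanishes for degree reasons. *)
Lemma supp_zw : HB G 1 6 = 0%N ->
  forall a b c d, G@_(mon4 a b c d) != 0 -> (c + d <= 1)%N \/ (a + b + c + d = 14)%N.
Proof.
move=> HB16 a b c d nzG.
have [|] := boolP ((c + d <= 1) || (a + b + c + d == 14))%N.
  by move/orP => [|/eqP]; [left | right].
rewrite negb_or -ltnNge => /andP[cd2 deg]; exfalso.
have deg13 : (a + b + c + d = 13)%N by have := suppG nzG; lia.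
have [m0 [m1 [m2 [m3 [n0 [n1 [n2 [n3]]]]]]]] := split_zw deg13 cd2.
move=> [ea [eb [ec [ed [m6 [m_zw n_zw]]]]]].
have : Cpre G 2 6 'X_[mon4 m0 m1 m2 m3].
  apply: Cpre_2_6; rewrite ?mdeg_mon4 //.
  by rewrite !multinomE !(tnth_nth 0%N) /= !inordK.
case/Cpre_pairing => _ [h h7 /(_ (mon4 n0 n1 n2 n3))].
rewrite degG mdeg_mon4 pairingX mon4D -ea -eb -ec -ed => /(_ ltac:(lia)) e.
case/negP: nzG; rewrite e; apply/eqP.
apply: pairing_eq0 => x; case: (mon4P x) => a0 a1 a2 a3 /(mpow_mon4 h7) le_7.
by rewrite mon4D; apply: G_eq0; lia.
Qed.

(** * Consequences of [g13 = c + Z P + W Q] *)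

Section Zw.
Hypothesis suppzw : forall a b c d, G@_(mon4 a b c d) != 0 ->
  (c + d <= 1)%N \/ (a + b + c + d = 14)%N.
Hypothesis unitT : T \in unitmx.

(** In degree 11, [f o G] comes from the [x, y] part of [f] acting on [g], and it vanishes because
    [h] in [m^4] leaves nothing there. Injectivity on [R_7] gives injectivity on [R_3]. *)
Lemma Cpre_1_3_coef f i : f \is 3.-homog -> Cpre G 1 3 f -> (i < 4)%N ->
  f@_(mon4 i (3 - i) 0 0) = 0.
Proof.
move=> /mpow_homog f3 /Cpre_pairing[_ [h h4 fh]] lt_i4.
(* The coefficients of [y^4] times the [x, y] part of [f], a form of degree 7. *)
pose r : 'rV[k]_(4 + 4) := row_mx (\row_j f@_(mon4 j (3 - j) 0 0)) 0.
have rl j : r 0 (lshift 4 j) = f@_(mon4 j (3 - j) 0 0) by rewrite row_mxEl mxE.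
have rr j : r 0 (rshift 4 j) = 0 by rewrite row_mxEr mxE.
suff r0 : r = 0.
  have := congr1 (fun M : 'rV_ _ => M 0 (lshift 4 (Ordinal lt_i4))) r0.
  by rewrite rl mxE.
apply: (can_inj (mulmxK unitT)); rewrite mul0mx; apply/rowP => b; rewrite mxE [RHS]mxE.
have lt_b8 := ltn_ord b.
have := fh (mon4 b (11 - b) 0 0); rewrite (pairing_gam (d := 3)) //; last by lia.
rewrite degG mdeg_mon4 => /(_ ltac:(lia)).
rewrite [RHS]pairing_eq0; last first.
  move=> a; case: (mon4P a) => a0 a1 a2 a3 /(mpow_mon4 h4) le_a.
  by rewrite mon4D; apply: G_eq0; lia.
move=> e0; rewrite -[RHS]e0 (@big_split_ord _ _ _ 4 4) /=.
rewrite [X in _ + X]big1 ?addr0 => [|j _]; last by rewrite rr mul0r.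
by apply: eq_bigr => j _; rewrite rl [T _ _]mxE.
Qed.

(** With [f = z q + w q'] up to terms with two factors among [z, w], this is a coefficient of
    [q o P + q' o Q]. *)
Lemma pairing_zw f b : f \is 3.-homog ->
  (forall i, (i < 4)%N -> f@_(mon4 i (3 - i) 0 0) = 0) -> (b <= 10)%N ->
  pairing G (mon4 b (10 - b) 0 0) f =
    \sum_(i < 3) f@_(mon4 i (2 - i) 1 0) * pz (i + b) +
    \sum_(i < 3) f@_(mon4 i (2 - i) 0 1) * pw (i + b).
Proof.
move=> f_homog f_pure le_b.
rewrite (@pairing_seq _ _ _ _ ([seq mon4 i (2 - i) 1 0 | i : 'I_3] ++
                               [seq mon4 i (2 - i) 0 1 | i : 'I_3])).
- rewrite big_cat !big_image /=; congr (_ + _); apply: eq_bigr => i _;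
    by congr (_ * _); rewrite mon4D; congr (G@_(mon4 _ _ _ _)); have := ltn_ord i; lia.
- rewrite cat_uniq; apply/and3P; split.
  + by rewrite map_inj_uniq ?enum_uniq // => i j /mon4_inj1/val_inj.
  + by apply/hasPn => _ /mapP[i _ ->]; apply/negP => /mapP[j _ /mon4_inj3].
  by rewrite map_inj_uniq ?enum_uniq // => i j /mon4_inj1/val_inj.
move=> a; case: (mon4P a) => a0 a1 a2 a3 nz.
have deg3 := homog_mon4 f_homog nz; rewrite mon4D => nzG.
have [zw|] := suppzw nzG; last by lia.
have pure : (0 < a2 + a3)%N.
  rewrite lt0n; apply: contra_neqN nz => /eqP zw0.
  have [-> [-> ->]] : (a2 = 0 /\ a3 = 0 /\ a1 = 3 - a0)%N by lia.
  by apply: f_pure; lia.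
have lt_a0 : (a0 < 3)%N by lia.
rewrite mem_cat; apply/orP; have [a2E|a2E] : (a2 = 1 \/ a2 = 0)%N by lia.
  left; apply/mapP; exists (Ordinal lt_a0); rewrite ?mem_enum //=.
  by congr mon4; lia.
right; apply/mapP; exists (Ordinal lt_a0); rewrite ?mem_enum //=.
by congr mon4; lia.
Qed.

(** Six cubics in [C(1)] independent modulo [C(2)] have no [x, y] part. A combination with
    [q o P + q' o Q = 0] lies in [C(2)], so the six images in [R_2 o P + R_2 o Q] are
    independent. *)
Lemma rank_hankel2_3_11 : HB G 1 3 = 6 -> (6 <= \rank (hankel2 3 11 pz pw))%N.
Proof.
move=> HB13; have := HB_has_qdim G 1 3; rewrite HB13.
move=> /has_qdim_homog[v [v_homog vV vU]].
pose A : 'M[k]_(6, 3) := \matrix_(l, i) (v l)@_(mon4 i (2 - i) 1 0).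
pose B : 'M[k]_(6, 3) := \matrix_(l, i) (v l)@_(mon4 i (2 - i) 0 1).
suff /eqP rankAB : row_free (row_mx A B *m (hankel2 3 11 pz pw)^T).
  by rewrite -mxrank_tr -[X in (X <= _)%N]rankAB mxrankM_maxr.
apply: row_free_of_ker => u u0; apply/rowP => l; rewrite mxE.
apply: (vU (u 0)); set f := \sum_l _.
have f_homog : f \is 3.-homog by apply: rpred_sum => j _; apply/rpredZ/v_homog.
have f3 := mpow_homog f_homog.
have f_pure i : (i < 4)%N -> f@_(mon4 i (3 - i) 0 0) = 0.
  by apply: Cpre_1_3_coef => //; apply: Cpre_sum.
(* The bound 10 is [14 + 1 - 2 - 3]; higher degrees see only the absent [x, y] part of [f]. *)
apply: Cpre_intro => // c; rewrite leq_eqVlt => /orP[|]; last first.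
  move=> le_c; apply: (pairing_top f3 le_c) => b le_b; rewrite pairing_gam //.
  by rewrite big1 // => i _; rewrite f_pure ?mul0r.
case: (mon4P c) => c0 c1 c2 c3; rewrite mdeg_mon4 => /eqP deg10.
have [[c0_le [-> [-> ->]]]|nc] :
    (c0 <= 10 /\ c1 = 10 - c0 /\ c2 = 0 /\ c3 = 0 \/ 0 < c2 + c3)%N by lia.
  rewrite pairing_zw //.
  have := congr1 (fun M : 'rV_ _ => M 0 (inord c0)) u0.
  rewrite tr_row_mx !trmx_hankel mul_row_col mulmxDr !mulmxA !mxE => e0.
  rewrite -[RHS]e0; congr (_ + _); apply: eq_bigr => i _;
    rewrite !mxE inordK ?ltnS //; congr (_ * _);
    by rewrite raddf_sum /=; apply: eq_bigr => j _; rewrite mcoeffZ mxE.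
apply: pairing_eq0 => a; case: (mon4P a) => a0 a1 a2 a3 nz.
have deg3 := homog_mon4 f_homog nz; rewrite mon4D.
apply: contra_neq_eq nz => nzG; have [zw|] := suppzw nzG; last first.
  by have := suppG nzG; lia.
have [-> [-> ->]] : (a2 = 0 /\ a3 = 0 /\ a1 = 3 - a0)%N by lia.
by apply: f_pure; lia.
Qed.

(** A rank below 6 in degree 7 would persist in degrees 8, 9 and 10, being below the dimension of
    the space of forms at each step. *)
Lemma rank_hankel2_6_8 : HB G 1 3 = 6 -> (6 <= \rank (hankel2 6 8 pz pw))%N.
Proof.
move=> /rank_hankel2_3_11 rank6; rewrite leqNgt; apply/negP => lt6.
have := @mxrank_hankel2 _ 5 8 pz pw; have := @mxrank_hankel2 _ 4 9 pz pw.
have := @mxrank_hankel2 _ 3 10 pz pw; lia.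
Qed.

(** The monomial bases of [z R_5] and [w R_5], in the column order of [hankel2 6 8]. *)
Definition zw_mon (r : 'I_(6 + 6)) : 'X_{1..4} :=
  match split r with
  | inl i => mon4 i (5 - i) 1 0
  | inr i => mon4 i (5 - i) 0 1
  end.

Lemma G_zw_mon r b : (b < 8)%N ->
  G@_(zw_mon r + mon4 b (7 - b) 0 0) = hankel2 6 8 pz pw (inord b) r.
Proof.
move=> lt_b8; rewrite /zw_mon mxE; case: splitP => i _; rewrite mxE inordK //;
  by rewrite mon4D; congr (G@_(mon4 _ _ _ _)); have := ltn_ord i; lia.
Qed.

Lemma pairing_zw_mpow7 h b c d : mpow 7 h -> (b < 6)%N -> (c + d = 1)%N ->
  pairing G (mon4 b (5 - b) c d) h =
    \sum_(i < 8) h@_(mon4 i (7 - i) 0 0) * G@_(mon4 (i + b) (12 - (i + b)) c d).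
Proof.
move=> h7 lt_b cd1.
rewrite (@pairing_seq _ _ _ _ [seq mon4 i (7 - i) 0 0 | i : 'I_8]).
- rewrite big_map big_enum; apply: eq_bigr => i _; congr (_ * _).
  by rewrite mon4D; congr (G@_(mon4 _ _ _ _)); have := ltn_ord i; lia.
- by rewrite map_inj_uniq ?enum_uniq // => i j /mon4_inj1/val_inj.
move=> a; case: (mon4P a) => a0 a1 a2 a3 /(mpow_mon4 h7) le_7; rewrite mon4D.
move=> nzG; have := suppG nzG; have := suppzw nzG => zw supp.
have lt_a0 : (a0 < 8)%N by lia.
apply/mapP; exists (Ordinal lt_a0); rewrite ?mem_enum //=.
by congr mon4; lia.
Qed.

Local Notation N := (hankel2 6 8 pz pw)^T.

(* On the span of [z R_5 + w R_5], the elements of C(3) lie in the kernel of the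
   form [(f, f') |-> (r r') o g], where [r o g = f o g13] and [r' o g = f' o g13]. *)
Lemma Cpre_3_6_ker (u : 'rV[k]_(6 + 6)) :
  Cpre G 3 6 (\sum_r u 0 r *: 'X_[zw_mon r]) -> u *m (N *m invmx T *m N^T) = 0.
Proof.
case/Cpre_pairing => _ [h h7]; rewrite degG => fh.
pose e : 'rV[k]_8 := \row_i h@_(mon4 i (7 - i) 0 0).
have pairing_f c : pairing G c (\sum_r u 0 r *: 'X_[zw_mon r]) =
    \sum_r u 0 r * G@_(zw_mon r + c).
  by rewrite linear_sum; apply: eq_bigr => r _; rewrite linearZ /= pairingX.
(* In degree 7 the comparison with [h] reads [f o g13 = r o g], where [e] lists the coefficients of
   [r]. *)
have uN : u *m N = e *m T.
  apply/rowP => b; have lt_b8 := ltn_ord b.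
  have := fh (mon4 b (7 - b) 0 0); rewrite pairing_f (pairing_gam (d := 7)) //.
  rewrite mdeg_mon4 => /(_ ltac:(lia)) eq_b; rewrite mxE [RHS]mxE.
  transitivity (\sum_r u 0 r * G@_(zw_mon r + mon4 b (7 - b) 0 0)).
    by apply: eq_bigr => r _; rewrite G_zw_mon // mxE inord_val.
  by rewrite eq_b; apply: eq_bigr => i _; rewrite !mxE.
have small c : mdeg c = 6 -> pairing G c (\sum_r u 0 r *: 'X_[zw_mon r]) = 0.
  case: (mon4P c) => c0 c1 c2 c3; rewrite mdeg_mon4 pairing_f => deg6.
  rewrite big1 // => r _; rewrite /zw_mon; case: splitP => i _;
    by rewrite mon4D G_eq0 ?mulr0 //; have := ltn_ord i; lia.
(* In degree 6, monomials with one [Z] or [W] read off [r o P] and [r o Q], which vanish because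
   [f o G] has no term of degree 6. *)
have eN : e *m N^T = 0.
  rewrite trmxK mul_mx_row -[RHS]row_mx0; congr row_mx; apply/rowP => b;
    have lt_b6 := ltn_ord b; rewrite !mxE.
    have := fh (mon4 b (5 - b) 1 0); rewrite small ?pairing_zw_mpow7 // mdeg_mon4;
      last by lia.
    by move=> /(_ ltac:(lia)) e0; rewrite [RHS]e0; apply: eq_bigr => i _; rewrite !mxE.
  have := fh (mon4 b (5 - b) 0 1); rewrite small ?pairing_zw_mpow7 // mdeg_mon4;
    last by lia.
  by move=> /(_ ltac:(lia)) e0; rewrite [RHS]e0; apply: eq_bigr => i _; rewrite !mxE.
by rewrite !mulmxA uN mulmxK // eN.
Qed.

End Zw.

Lemma HB_2_6_ge : HB G 0 7 = 8 -> HB G 1 6 = 0%N -> HB G 1 3 = 6 ->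
  (4 <= HB G 2 6)%N.
Proof.
move=> HB07 HB16 HB13.
have unitT := hankel_gam_unit HB07; have zw := supp_zw HB16.
have rank6 := rank_hankel2_6_8 zw unitT HB13.
have [vs [_ _ span]] := HB_has_qdim G 2 6; move: (HB G 2 6) vs span => n vs span.
have unitTV : invmx T \in unitmx by rewrite unitmx_inv.
have zwC r : Cpre G 2 6 'X_[zw_mon r].
  apply: Cpre_2_6 => //; rewrite /zw_mon; case: splitP => i _;
    rewrite ?mdeg_mon4 ?multinomE ?(tnth_nth 0%N) /= ?inordK //=;
    by have := ltn_ord i; lia.
(* Each monomial is expanded on [n] elements modulo [C(3)]. A row killed by [C] gives an element of
   [C(3)], hence of the kernel of the form, so the form has rank at most [n]. *)
have /fin_all_exists[c cC] r := span _ (zwC r).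
pose C : 'M[k]_(6 + 6, n) := \matrix_(r, j) c r j.
have := mxrank_congr_ge (hankel2 6 8 pz pw)^T unitTV.
rewrite mxrank_tr => le_rank.
suff le_C : (\rank ((hankel2 6 8 pz pw)^T *m invmx T *m (hankel2 6 8 pz pw)^T^T)
    <= \rank C)%N.
  by have := rank_leq_col C; lia.
apply: mxrank_le_of_ker => u uC; apply: Cpre_3_6_ker => //.
have := Cpre_sum (u 0) cC; congr Cpre.
under eq_bigr do rewrite scalerBr scaler_sumr; rewrite sumrB exchange_big /=.
rewrite [X in _ - X]big1 ?subr0 // => j _.
have := congr1 (fun M : 'rV_ _ => M 0 j) uC; rewrite !mxE => uC0.
under eq_bigr do rewrite scalerA; rewrite -scaler_suml.
rewrite (_ : \sum_r _ = 0) ?scale0r // -[RHS]uC0.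
by apply: eq_bigr => r _; rewrite mxE.
Qed.

End Coordinates.

(** If [G] had degree below 14, [m^14] would annihilate it and the degree 14 piece would vanish. *)
Lemma HB_0_14_degDP (k : fieldType) (G : {mpoly k[4]}) :
  (msize G <= 15)%N -> HB G 0 14 = 1%N -> degDP G = 14.
Proof.
move=> le15 HB014; rewrite /degDP.
have [lt|/negPf] := boolP (msize G <= 14)%N; last by lia.
have := HB_has_qdim G 0 14; rewrite HB014 => -[vs [vsV vsU _]].
suff /(_ ord0)/eqP : forall i : 'I_1, (fun=> 1 : k) i = 0 by rewrite oner_eq0.
apply: vsU; rewrite big_ord1 scale1r; apply: Cpre_inmB; apply/inmBP.
exists 0; first exact: mpow0.
have /Cpre_sub_inmB/inmBP[h h14 vh] := vsV ord0.
move=> c; rewrite linear0 vh; move: c; apply/Ann_pairing/Ann_mpow => a /h14.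
exact: leq_trans.
Qed.

Theorem theorem1p49 (k : fieldType) (g g13 : {mpoly k[4]}) :
  inD 14 g ->
  g13 \is 13.-homog ->
  (forall i, HB (g + g13) 0 i =
     nth 0%N [:: 1; 2; 3; 4; 5; 6; 7; 8; 7; 6; 5; 4; 3; 2; 1]%N i) ->
  (forall i, HB (g + g13) 1 i =
     nth 0%N [:: 0; 2; 4; 6; 4; 2; 0; 0; 2; 4; 6; 4; 2; 0]%N i) ->
  (4 <= HB (g + g13) 2 6)%N.
Proof.
move=> [g_homog gXY] g13_homog HB0 HB1.
have suppG a b c d : (g + g13)@_(mon4 a b c d) != 0 ->
    (a + b + c + d = 13 \/ a + b = 14 /\ c + d = 0)%N.
  rewrite mcoeffD; have [ga|/memN_msupp_eq0 ->] := boolP (mon4 a b c d \in msupp g).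
    have [c0 d0] := gXY _ ga; rewrite mcoeff_msupp in ga.
    by have := homog_mon4 g_homog ga; move: c0 d0;
      rewrite !multinomE !(tnth_nth 0%N) /=; right; lia.
  by rewrite add0r => /(homog_mon4 g13_homog); left.
have le15 : (msize (g + g13) <= 15)%N.
  rewrite msizeE big_seq; elim/big_rec: _ => // m n m_supp le_n.
  rewrite geq_max le_n andbT; case: (mon4P m) m_supp => a b c d.
  by rewrite mcoeff_msupp mdeg_mon4 => /suppG; lia.
apply: HB_2_6_ge; rewrite ?HB0 ?HB1 //.
by apply: HB_0_14_degDP; rewrite ?HB0.
Qed.
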